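(* Let $X := \{(x,y)\in\mathbb{R}^2 \mid y>0\} \cup \{(x,0) \mid x\geq 0\}\subset\mathbb{R}^2$. There exists a function $f\colon X\to\mathbb{R}$ that does not extend to a $C^\infty$ function on any open neighbourhood of $X$ in $\mathbb{R}^2$, but that, for each $k\in\mathbb{N}$, extends to a $C^k$ function on some open neighbourhood of $X$ in $\mathbb{R}^2$.
   Context: An open neighbourhood of $X$ in $\mathbb{R}^2$ is an open subset of $\mathbb{R}^2$ containing $X$. The open neighbourhood on which the $C^k$ extension is defined may depend on $k$. *)

(* Defs.v *)
From Stdlib Require Import Reals.
From Coquelicot Require Import Coquelicot.
Open Scope R_scope.

Definition X (p : R * R) : Prop :=
  0 < snd p \/ (0 <= fst p /\ snd p = 0).

(* A function on an open set [U] is represented by a total function whose values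
   off [U] are irrelevant: [ex_diff_n g k] at a point only involves the germ of
   [g] there.  At every point of an open [U] it says that all iterated partial
   derivatives of order at most [k] exist and are continuous. *)
Definition Ck_on (k : nat) (U : R * R -> Prop) (g : R * R -> R) : Prop :=
  forall p : R * R, U p -> ex_diff_n (fun x y => g (x, y)) k (fst p) (snd p).

Definition Cinfty_on (U : R * R -> Prop) (g : R * R -> R) : Prop :=
  forall k : nat, Ck_on k U g.

Definition open_nbhd (A U : R * R -> Prop) : Prop :=
  open U /\ (forall p : R * R, A p -> U p).

Definition extends {A : R * R -> Prop} (g : R * R -> R)
    (f : {p : R * R | A p} -> R) : Prop :=
  forall p : {p : R * R | A p}, g (proj1_sig p) = f p.

(* Main.v *)
Require Import Defs.
From Stdlib Require Import Reals Lra Lia.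
From Coquelicot Require Import Coquelicot.
Open Scope R_scope.

(** The function is [(y exp(-y)) ^ (1 / |x|)] on the quadrant [x < 0 < y] and
    [0] elsewhere on [X].  Its vertical slice at [x < 0] behaves like a power of
    [y] with exponent [1 / |x|], which tends to infinity as [x] tends to [0-].

    Near the origin the exponent is large, so extending by [0] to [y <= 0]
    gives a function of class C^k where [x > - 1 / (k + 3)]: together with the
    upper half-plane, this is the neighbourhood [slit_domain k], and one and the
    same total function serves for every [k].  To see the regularity, put
    [s = - 1 / x] and [l = y - ln y >= 1], so that [y exp(-y) = exp(-l)].  The
    functions [s^i l^j y^(-m) exp(-s l)], extended by [0] ([mono]), have partial
    derivatives that are linear combinations of functions of the same kind, and
    each derivative raises [m] by at most [1].  As long as [1 / |x| >= m + 3],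
    the exponential absorbs all other factors and leaves a bound by a constant
    times [x^2] and times [y^2] ([mono_le_sqr]).  Hence every such function is
    continuous and has zero gradient at the points of the boundary of the
    quadrant with [x > - 1 / (m + 3)], and an induction on [k] finishes
    ([mono_Ck]).

    A smooth extension, on the other hand, would be defined on a disc around
    the origin, and that disc contains a boundary point with
    [x = - 1 / (n + 1/2)].  On this vertical line the extension is a smooth
    function of [y] that equals [y ^ (n + 1/2)] up to a positive smooth factor
    for [y > 0].  Taylor's formula forces its derivatives at [0] of order at
    most [n] to vanish; then it is O(y^(n+1)), which is absurd
    ([half_order_not_smooth]). *)

(** * Functions of class C^k on an open set, with explicit derivatives *)

(** Witnessing the partial derivatives on all of [U], rather than taking
    [Derive] at one point as [ex_diff_n] does, makes sums and products by
    constants immediate and lets a family of functions that is closed under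
    differentiation be treated by induction on [k]. *)
Fixpoint Ck_witnessed (U : R * R -> Prop) (k : nat) (f : R -> R -> R) : Prop :=
  (forall x y, U (x, y) -> continuity_2d_pt f x y) /\
  match k with
  | O => True
  | S k' => exists fx fy : R -> R -> R,
      (forall x y, U (x, y) -> is_derive (fun t => f t y) x (fx x y)) /\
      (forall x y, U (x, y) -> is_derive (fun t => f x t) y (fy x y)) /\
      Ck_witnessed U k' fx /\ Ck_witnessed U k' fy
  end.

Lemma open_locally_2d (U : R * R -> Prop) (x y : R) :
  open U -> U (x, y) -> locally_2d (fun u v => U (u, v)) x y.
Proof.
  intros HU Hp.
  apply locally_2d_locally.
  generalize (HU _ Hp); apply filter_imp.
  now intros [u v].
Qed.

(** Openness is what allows the witnesses to replace the operator [Derive]: they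
    agree with it on a neighbourhood of each point, so they can be
    differentiated in its place. *)
Lemma Ck_witnessed_ex_diff_n (U : R * R -> Prop) (k : nat) :
  open U -> forall f, Ck_witnessed U k f ->
  forall x y, U (x, y) -> ex_diff_n f k x y.
Proof.
  intros HU.
  induction k as [|k IH]; intros f [Hc Hd] x y Hp; simpl.
  { split; [now apply Hc | exact I]. }
  destruct Hd as [fx [fy [Hx [Hy [Kx Ky]]]]].
  split; [now apply Hc|].
  split; [eexists; now apply Hx|].
  split; [eexists; now apply Hy|].
  split.
  - apply ex_diff_n_ext_loc with fx; [|now apply IH].
    generalize (open_locally_2d U x y HU Hp); apply locally_2d_impl.
    apply locally_2d_forall; intros u v Huv.
    symmetry; apply is_derive_unique; now apply Hx.
  - apply ex_diff_n_ext_loc with fy; [|now apply IH].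
    generalize (open_locally_2d U x y HU Hp); apply locally_2d_impl.
    apply locally_2d_forall; intros u v Huv.
    symmetry; apply is_derive_unique; now apply Hy.
Qed.

Lemma Ck_witnessed_plus (U : R * R -> Prop) (k : nat) : forall f g,
  Ck_witnessed U k f -> Ck_witnessed U k g ->
  Ck_witnessed U k (fun x y => f x y + g x y).
Proof.
  induction k as [|k IH]; intros f g [Hf Df] [Hg Dg]; split.
  1, 3: intros x y Hp; apply continuity_2d_pt_plus; auto.
  - exact I.
  - destruct Df as [fx [fy [Hx [Hy [Kx Ky]]]]].
    destruct Dg as [gx [gy [Gx [Gy [Lx Ly]]]]].
    exists (fun x y => fx x y + gx x y), (fun x y => fy x y + gy x y).
    split; [|split; [|split; apply IH; assumption]].
    + intros x y Hp; apply (is_derive_plus (V := R_NormedModule)); auto.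
    + intros x y Hp; apply (is_derive_plus (V := R_NormedModule)); auto.
Qed.

Lemma Ck_witnessed_scal (U : R * R -> Prop) (c : R) (k : nat) : forall f,
  Ck_witnessed U k f -> Ck_witnessed U k (fun x y => c * f x y).
Proof.
  induction k as [|k IH]; intros f [Hf Df]; split.
  1, 3: intros x y Hp; apply continuity_2d_pt_mult;
        [apply continuity_2d_pt_const | auto].
  - exact I.
  - destruct Df as [fx [fy [Hx [Hy [Kx Ky]]]]].
    exists (fun x y => c * fx x y), (fun x y => c * fy x y).
    split; [|split; [|split; apply IH; assumption]].
    + intros x y Hp. apply is_derive_scal; auto.
    + intros x y Hp. apply is_derive_scal; auto.
Qed.

(** * Exponential decay against powers *)

(** With [u = c t / (n + 1)], the inequality [u <= exp u] gives
    [u^n <= exp(n u) <= exp(c t)]; dividing by [n + 1] rather than by [n] keeps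
    the case [n = 0] uniform. *)
Lemma pow_exp_bounded (c : R) (n : nat) : 0 < c ->
  exists C, forall t, 0 <= t -> t ^ n * exp (- (c * t)) <= C.
Proof.
  intros Hc.
  assert (HN : 0 < INR (S n)) by (apply lt_0_INR; lia).
  exists ((INR (S n) / c) ^ n); intros t Ht.
  set (u := c * t / INR (S n)).
  assert (Hu : 0 <= u) by (apply Rdiv_le_0_compat; [nra | lra]).
  replace t with (INR (S n) / c * u) at 1 by (unfold u; field; lra).
  rewrite Rpow_mult_distr, Rmult_assoc.
  rewrite <- (Rmult_1_r ((INR (S n) / c) ^ n)) at 2.
  apply Rmult_le_compat_l.
  { apply pow_le, Rlt_le, Rdiv_lt_0_compat; lra. }
  assert (H1 : u ^ n <= exp (c * t)).
  { apply Rle_trans with (exp u ^ n).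
    - apply pow_incr; split; [exact Hu|].
      generalize (exp_ineq1_le u); lra.
    - rewrite <- Rpower_pow by apply exp_pos.
      unfold Rpower; rewrite ln_exp.
      replace (c * t) with (INR (S n) * u) by (unfold u; field; lra).
      rewrite S_INR.
      destruct (Req_dec u 0) as [E|E]; [rewrite E, !Rmult_0_r; lra|].
      left; apply exp_increasing; nra. }
  apply Rle_trans with (exp (c * t) * exp (- (c * t))).
  - apply Rmult_le_compat_r; [left; apply exp_pos | exact H1].
  - rewrite <- exp_plus, Rplus_opp_r, exp_0; lra.
Qed.

Lemma exp_le_compat (a b : R) : a <= b -> exp a <= exp b.
Proof.
  intros [H | ->]; [left; now apply exp_increasing | lra].
Qed.

(** Since [v^m <= exp(m l)] and [s >= m + 1], the factor [v^m] uses up at most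
    the share [m / (m + 1)] of the decay of [exp(- s l)].  The rest still
    dominates [(s l)^(i + j)], which bounds [s^i l^j] because [s] and [l] are at
    least [1]. *)
Lemma monomial_bounded (i j m : nat) :
  exists C, forall s l v, INR m + 1 <= s -> 1 <= l -> 0 <= v <= exp l ->
    s ^ i * l ^ j * v ^ m * exp (- (s * l)) <= C.
Proof.
  generalize (pos_INR m); intros Hm.
  destruct (pow_exp_bounded (/ (INR m + 1)) (i + j)) as [C HC].
  { apply Rinv_0_lt_compat; lra. }
  exists C; intros s l v Hs Hl Hv.
  apply Rle_trans with (2 := HC (s * l) ltac:(nra)).
  rewrite Rmult_assoc.
  apply Rmult_le_compat.
  - apply Rmult_le_pos; apply pow_le; lra.
  - apply Rmult_le_pos; [apply pow_le; lra | left; apply exp_pos].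
  - rewrite pow_add; apply Rmult_le_compat; try (apply pow_le; lra).
    + apply pow_incr; nra.
    + apply pow_incr; nra.
  - apply Rle_trans with (exp (INR m * l) * exp (- (s * l))).
    + apply Rmult_le_compat_r; [left; apply exp_pos|].
      apply Rle_trans with (exp l ^ m); [now apply pow_incr|].
      rewrite <- Rpower_pow by apply exp_pos.
      unfold Rpower; rewrite ln_exp; lra.
    + rewrite <- exp_plus; apply exp_le_compat.
      assert (E : INR m <= s - / (INR m + 1) * s).
      { replace (s - / (INR m + 1) * s) with (s * / (INR m + 1) * INR m)
          by (field; lra).
        assert (1 <= s * / (INR m + 1)).
        { apply Rmult_le_reg_r with (INR m + 1); [lra|].
          rewrite Rmult_assoc, Rinv_l; lra. }
        nra. }
      nra.
Qed.

(** * The family of monomials and its flatness *)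

(** With [s = - 1 / x] and [l = y - ln y], the value on the quadrant is
    [s^i l^j y^(-m) exp(- s l)].  The term [- ln y] produces
    the power of [y]; adding [y] makes [l >= 1] for all [y > 0], which gives
    decay as [s] tends to infinity, while the derivative [1 - 1 / y] keeps the
    span of the family closed under differentiation. *)
Definition mono (i j m : nat) (x y : R) : R :=
  if Rlt_dec x 0 then
    if Rlt_dec 0 y then
      (- / x) ^ i * (y - ln y) ^ j * (/ y) ^ m * exp (/ x * (y - ln y))
    else 0
  else 0.

Lemma mono_quadrant (i j m : nat) (x y : R) : x < 0 -> 0 < y ->
  mono i j m x y =
  (- / x) ^ i * (y - ln y) ^ j * (/ y) ^ m * exp (/ x * (y - ln y)).
Proof.
  intros Hx Hy; unfold mono.
  destruct (Rlt_dec x 0); [|lra]; destruct (Rlt_dec 0 y); [reflexivity|lra].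
Qed.

Lemma mono_off_quadrant (i j m : nat) (x y : R) : 0 <= x \/ y <= 0 ->
  mono i j m x y = 0.
Proof.
  intros H; unfold mono.
  destruct (Rlt_dec x 0); [|reflexivity].
  destruct (Rlt_dec 0 y); [lra|reflexivity].
Qed.

Lemma one_le_sub_ln (y : R) : 0 < y -> 1 <= y - ln y.
Proof.
  intros Hy; generalize (exp_ineq1_le (ln y)); rewrite exp_ln; lra.
Qed.

(** The factors [s^2] and [y^(-2)] that turn the two bounds into bounds on
    monomials are absorbed like the others, which is why the exponent [s] has to
    exceed [m + 2]. *)
Lemma mono_le_sqr (i j m : nat) :
  exists C, 0 <= C /\ forall x y, - / (INR m + 3) < x < 0 -> 0 < y ->
    Rabs (mono i j m x y) <= C * x ^ 2 /\ Rabs (mono i j m x y) <= C * y ^ 2.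
Proof.
  generalize (pos_INR m); intros Hm.
  destruct (monomial_bounded (i + 2) j m) as [C1 H1].
  destruct (monomial_bounded i j (m + 2)) as [C2 H2].
  exists (Rmax 0 (Rmax C1 C2)); split; [apply Rmax_l|].
  intros x y Hx Hy.
  assert (Hs : INR m + 3 <= - / x).
  { rewrite <- Rinv_opp.
    rewrite <- (Rinv_inv (INR m + 3)).
    apply Rinv_le_contravar; lra. }
  generalize (one_le_sub_ln y Hy); intros Hl.
  assert (Hv : 0 <= / y <= exp (y - ln y)).
  { split; [left; now apply Rinv_0_lt_compat|].
    rewrite <- (exp_ln (/ y)) by now apply Rinv_0_lt_compat.
    rewrite ln_Rinv by assumption.
    apply exp_le_compat; lra. }
  specialize (H1 (- / x) (y - ln y) (/ y) ltac:(lra) Hl Hv).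
  specialize (H2 (- / x) (y - ln y) (/ y)
                ltac:(rewrite plus_INR; simpl; lra) Hl Hv).
  replace (- (- / x * (y - ln y))) with (/ x * (y - ln y)) in H1, H2 by ring.
  rewrite Rabs_pos_eq.
  2: { rewrite mono_quadrant by lra.
       repeat apply Rmult_le_pos; try (apply pow_le; lra).
       left; apply exp_pos. }
  generalize (Rmax_r 0 (Rmax C1 C2)) (Rmax_l C1 C2) (Rmax_r C1 C2); intros.
  split.
  - apply Rle_trans with (C1 * x ^ 2); [|apply Rmult_le_compat_r; [nra | lra]].
    rewrite mono_quadrant by lra.
    eapply Rle_trans; [|apply Rmult_le_compat_r; [nra | exact H1]].
    rewrite pow_add; right; field; lra.
  - apply Rle_trans with (C2 * y ^ 2); [|apply Rmult_le_compat_r; [nra | lra]].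
    rewrite mono_quadrant by lra.
    eapply Rle_trans; [|apply Rmult_le_compat_r; [nra | exact H2]].
    rewrite pow_add; right; field; lra.
Qed.

(** At a boundary point with [x0 >= 0], points of the quadrant satisfy
    [|x| <= |x - x0|] and the bound by [x^2] applies; at one with [y0 <= 0],
    likewise [y <= |y - y0|] and the bound by [y^2] applies. *)
Lemma mono_flat (i j m : nat) (x0 y0 : R) :
  0 <= x0 \/ y0 <= 0 -> - / (INR m + 3) < x0 ->
  exists C, 0 <= C /\ locally_2d (fun x y =>
    Rabs (mono i j m x y) <= C * ((x - x0) ^ 2 + (y - y0) ^ 2)) x0 y0.
Proof.
  intros H0 Hx0.
  destruct (mono_le_sqr i j m) as [C [HC HM]].
  exists C; split; [exact HC|].
  assert (Hd : 0 < x0 + / (INR m + 3)) by lra.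
  exists (mkposreal _ Hd); simpl; intros x y Hx _.
  apply Rabs_def2 in Hx.
  assert (Hpos : 0 <= C * ((x - x0) ^ 2 + (y - y0) ^ 2))
    by (apply Rmult_le_pos;
        [lra | now apply Rplus_le_le_0_compat; apply pow2_ge_0]).
  generalize (pow2_ge_0 (x - x0)) (pow2_ge_0 (y - y0)); intros Sx Sy.
  destruct (Rlt_dec x 0) as [Lx|Lx];
    [|rewrite mono_off_quadrant, Rabs_R0; lra].
  destruct (Rlt_dec 0 y) as [Ly|Ly];
    [|rewrite mono_off_quadrant, Rabs_R0; lra].
  destruct (HM x y ltac:(lra) Ly) as [Bx By].
  destruct H0 as [H0|H0].
  - apply Rle_trans with (1 := Bx).
    apply Rmult_le_compat_l; nra.
  - apply Rle_trans with (1 := By).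
    apply Rmult_le_compat_l; nra.
Qed.

Lemma is_derive_0_of_sqr_bound (f : R -> R) (x C : R) : f x = 0 -> 0 <= C ->
  locally x (fun t => Rabs (f t) <= C * (t - x) ^ 2) -> is_derive f x 0.
Proof.
  intros Hf HC [d Hd].
  apply is_derive_Reals; intros eps Heps.
  assert (Hd' : 0 < Rmin d (eps / (C + 1))).
  { apply Rmin_pos; [apply cond_pos | apply Rdiv_lt_0_compat; lra]. }
  exists (mkposreal _ Hd'); simpl; intros h Hh Hlt.
  rewrite Hf, !Rminus_0_r.
  assert (B : Rabs (f (x + h)) <= C * h ^ 2).
  { replace (h ^ 2) with ((x + h - x) ^ 2) by ring.
    apply Hd; unfold ball; simpl.
    unfold AbsRing_ball, abs, minus, plus, opp; simpl.
    replace (x + h + - x) with h by ring.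
    apply Rlt_le_trans with (1 := Hlt), Rmin_l. }
  assert (Hh0 : 0 < Rabs h) by now apply Rabs_pos_lt.
  unfold Rdiv; rewrite Rabs_mult, Rabs_inv.
  apply Rmult_lt_reg_r with (Rabs h); [exact Hh0|].
  rewrite Rmult_assoc, Rinv_l, Rmult_1_r by lra.
  apply Rle_lt_trans with (1 := B).
  rewrite <- pow2_abs.
  assert (Rabs h * (C + 1) < eps).
  { apply Rlt_le_trans with (eps / (C + 1) * (C + 1)).
    - apply Rmult_lt_compat_r; [lra|].
      apply Rlt_le_trans with (1 := Hlt), Rmin_r.
    - right; field; lra. }
  nra.
Qed.

Lemma mono_continuous_flat (i j m : nat) (x0 y0 : R) :
  0 <= x0 \/ y0 <= 0 -> - / (INR m + 3) < x0 ->
  continuity_2d_pt (mono i j m) x0 y0.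
Proof.
  intros H0 Hx0 eps.
  destruct (mono_flat i j m x0 y0 H0 Hx0) as [C [HC [d Hd]]].
  rewrite mono_off_quadrant by assumption.
  assert (Hd' : 0 < Rmin d (Rmin 1 (eps / (2 * C + 1)))).
  { apply Rmin_pos; [apply cond_pos|]; apply Rmin_pos; [lra|].
    apply Rdiv_lt_0_compat; [apply cond_pos | lra]. }
  exists (mkposreal _ Hd'); simpl; intros u v Hu Hv.
  rewrite Rminus_0_r.
  apply Rmin_Rgt_l in Hu; destruct Hu as [Hu1 Hu].
  apply Rmin_Rgt_l in Hu; destruct Hu as [Hu2 Hu3].
  apply Rmin_Rgt_l in Hv; destruct Hv as [Hv1 Hv].
  apply Rmin_Rgt_l in Hv; destruct Hv as [Hv2 Hv3].
  apply Rle_lt_trans with (1 := Hd u v Hu1 Hv1).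
  rewrite <- (pow2_abs (u - x0)), <- (pow2_abs (v - y0)).
  generalize (Rabs_pos (u - x0)) (Rabs_pos (v - y0)); intros Pu Pv.
  generalize (cond_pos eps); intros He.
  set (e := eps / (2 * C + 1)) in *.
  assert (Ee : e * (2 * C + 1) = eps) by (unfold e; field; lra).
  assert (He0 : 0 < e) by lra.
  apply Rle_lt_trans with (C * (e + e)); [|nra].
  apply Rmult_le_compat_l; nra.
Qed.

Lemma quadrant_locally_2d (x0 y0 : R) : x0 < 0 -> 0 < y0 ->
  locally_2d (fun x y => x < 0 /\ 0 < y) x0 y0.
Proof.
  intros Hx Hy.
  assert (Hd : 0 < Rmin (- x0) y0) by (apply Rmin_pos; lra).
  exists (mkposreal _ Hd); simpl; intros u v Hu Hv.
  apply Rmin_Rgt_l in Hu; apply Rmin_Rgt_l in Hv.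
  destruct Hu as [Hu _], Hv as [_ Hv].
  apply Rabs_def2 in Hu; apply Rabs_def2 in Hv; lra.
Qed.

Lemma continuity_2d_pt_pow (f : R -> R -> R) (n : nat) (x y : R) :
  continuity_2d_pt f x y -> continuity_2d_pt (fun u v => f u v ^ n) x y.
Proof.
  intros Hf; induction n as [|n IH]; simpl.
  - apply continuity_2d_pt_const.
  - now apply continuity_2d_pt_mult.
Qed.

Lemma mono_continuous_quadrant (i j m : nat) (x y : R) : x < 0 -> 0 < y ->
  continuity_2d_pt (mono i j m) x y.
Proof.
  intros Hx Hy.
  apply continuity_2d_pt_ext_loc with (fun x y =>
    (- / x) ^ i * (y - ln y) ^ j * (/ y) ^ m * exp (/ x * (y - ln y))).
  { generalize (quadrant_locally_2d x y Hx Hy); apply locally_2d_impl.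
    apply locally_2d_forall; intros u v [Hu Hv].
    symmetry; now apply mono_quadrant. }
  assert (Cx : continuity_2d_pt (fun u _ => / u) x y).
  { apply continuity_2d_pt_inv; [apply continuity_2d_pt_id1 | lra]. }
  assert (Cl : continuity_2d_pt (fun _ v => v - ln v) x y).
  { apply continuity_2d_pt_minus; [apply continuity_2d_pt_id2|].
    apply (continuity_1d_2d_pt_comp ln (fun _ v => v));
      [|apply continuity_2d_pt_id2].
    apply derivable_continuous_pt; exists (/ y).
    now apply derivable_pt_lim_ln. }
  repeat apply continuity_2d_pt_mult; try apply continuity_2d_pt_pow.
  - now apply continuity_2d_pt_opp.
  - exact Cl.
  - apply continuity_2d_pt_inv; [apply continuity_2d_pt_id2 | lra].
  - apply (continuity_1d_2d_pt_comp exp (fun u v => / u * (v - ln v))).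
    + apply derivable_continuous_pt, derivable_pt_exp.
    + now apply continuity_2d_pt_mult.
Qed.

(** * Regularity of the monomials *)

(** On the quadrant this is the chain rule with [ds/dx = s^2]. *)
Definition mono_dx (i j m : nat) (x y : R) : R :=
  INR i * mono (i + 1) j m x y + (-1) * mono (i + 2) (j + 1) m x y.

(** On the quadrant this is the chain rule with [dl/dy = 1 - 1 / y].  For
    [j = 0] the truncated predecessor is harmless, its coefficient being [0]. *)
Definition mono_dy (i j m : nat) (x y : R) : R :=
  (INR j * mono i (pred j) m x y + (- INR j) * mono i (pred j) (m + 1) x y) +
  ((- INR m) * mono i j (m + 1) x y +
   ((-1) * mono (i + 1) j m x y + 1 * mono (i + 1) j (m + 1) x y)).

Lemma mono_is_derive_x_quadrant (i j m : nat) (x y : R) : x < 0 -> 0 < y ->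
  is_derive (fun t => mono i j m t y) x (mono_dx i j m x y).
Proof.
  intros Hx Hy.
  apply is_derive_ext_loc with (fun t =>
    (- / t) ^ i * (y - ln y) ^ j * (/ y) ^ m * exp (/ t * (y - ln y))).
  { generalize (locally_2d_1d_const_y _ _ _ (quadrant_locally_2d x y Hx Hy)).
    apply filter_imp; intros t [Ht _].
    symmetry; now apply mono_quadrant. }
  auto_derive; [lra|].
  unfold mono_dx; rewrite !mono_quadrant by assumption.
  destruct i as [|i].
  - simpl; rewrite Rmult_0_l. rewrite !pow_add; field; lra.
  - rewrite !pow_add; simpl pred. rewrite <- !tech_pow_Rmult; field; lra.
Qed.

Lemma mono_is_derive_y_quadrant (i j m : nat) (x y : R) : x < 0 -> 0 < y ->
  is_derive (fun t => mono i j m x t) y (mono_dy i j m x y).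
Proof.
  intros Hx Hy.
  apply is_derive_ext_loc with (fun t =>
    (- / x) ^ i * (t - ln t) ^ j * (/ t) ^ m * exp (/ x * (t - ln t))).
  { generalize (locally_2d_1d_const_x _ _ _ (quadrant_locally_2d x y Hx Hy)).
    apply filter_imp; intros t [_ Ht].
    symmetry; now apply mono_quadrant. }
  auto_derive; [repeat split; lra|].
  unfold mono_dy; rewrite !mono_quadrant by assumption.
  change (y + - ln y) with (y - ln y); rewrite !pow_add.
  generalize (y - ln y), (exp (/ x * (y - ln y))); intros l e.
  destruct m as [|m].
  - simpl; field; lra.
  - simpl pred; rewrite <- !tech_pow_Rmult; field; lra.
Qed.

(** The open upper half-plane together with the half-plane to the right of
    [x = - 1 / (N + 3)], where monomials with [m <= N] are flat on the boundary
    of the quadrant. *)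
Definition slit_domain (N : nat) (p : R * R) : Prop :=
  0 < snd p \/ - / (INR N + 3) < fst p.

Lemma slit_domain_flat (N m : nat) (x y : R) : (m <= N)%nat ->
  slit_domain N (x, y) -> 0 <= x \/ y <= 0 -> - / (INR m + 3) < x.
Proof.
  intros Hm Hp H0; apply le_INR in Hm.
  generalize (pos_INR m); intros Pm.
  assert (Hle : / (INR N + 3) <= / (INR m + 3))
    by (apply Rinv_le_contravar; lra).
  assert (0 < / (INR N + 3)) by (apply Rinv_0_lt_compat; lra).
  unfold slit_domain in Hp; simpl in Hp; lra.
Qed.

Lemma quadrant_dec (x y : R) : (x < 0 /\ 0 < y) \/ (0 <= x \/ y <= 0).
Proof. lra. Qed.

Lemma mono_continuous (N i j m : nat) (x y : R) : (m <= N)%nat ->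
  slit_domain N (x, y) -> continuity_2d_pt (mono i j m) x y.
Proof.
  intros Hm Hp.
  destruct (quadrant_dec x y) as [[Hx Hy]|H0].
  - now apply mono_continuous_quadrant.
  - apply mono_continuous_flat; [exact H0|].
    now apply (slit_domain_flat N m x y).
Qed.

Lemma mono_is_derive_x (N i j m : nat) (x y : R) : (m <= N)%nat ->
  slit_domain N (x, y) ->
  is_derive (fun t => mono i j m t y) x (mono_dx i j m x y).
Proof.
  intros Hm Hp.
  destruct (quadrant_dec x y) as [[Hx Hy]|H0].
  { now apply mono_is_derive_x_quadrant. }
  unfold mono_dx; rewrite !mono_off_quadrant by assumption.
  replace (_ + _) with 0 by ring.
  destruct (mono_flat i j m x y H0 (slit_domain_flat N m x y Hm Hp H0))
    as [C [HC HM]].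
  apply is_derive_0_of_sqr_bound with C;
    [now apply mono_off_quadrant | exact HC|].
  generalize (locally_2d_1d_const_y _ _ _ HM).
  apply filter_imp; intros t Ht.
  replace ((t - x) ^ 2) with ((t - x) ^ 2 + (y - y) ^ 2) by ring.
  exact Ht.
Qed.

Lemma mono_is_derive_y (N i j m : nat) (x y : R) : (m <= N)%nat ->
  slit_domain N (x, y) ->
  is_derive (fun t => mono i j m x t) y (mono_dy i j m x y).
Proof.
  intros Hm Hp.
  destruct (quadrant_dec x y) as [[Hx Hy]|H0].
  { now apply mono_is_derive_y_quadrant. }
  unfold mono_dy; rewrite !mono_off_quadrant by assumption.
  replace (_ + _) with 0 by ring.
  destruct (mono_flat i j m x y H0 (slit_domain_flat N m x y Hm Hp H0))
    as [C [HC HM]].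
  apply is_derive_0_of_sqr_bound with C;
    [now apply mono_off_quadrant | exact HC|].
  generalize (locally_2d_1d_const_x _ _ _ HM).
  apply filter_imp; intros t Ht.
  replace ((t - y) ^ 2) with ((x - x) ^ 2 + (t - y) ^ 2) by ring.
  exact Ht.
Qed.

(** One derivative costs at most one power of [1 / y], so the budget [m + k]
    never exceeds [N]. *)
Lemma mono_Ck (N k : nat) : forall i j m, (m + k <= N)%nat ->
  Ck_witnessed (slit_domain N) k (mono i j m).
Proof.
  induction k as [|k IH]; intros i j m Hm; split.
  1, 3: intros x y Hp; apply mono_continuous with N; [lia | exact Hp].
  - exact I.
  - exists (mono_dx i j m), (mono_dy i j m).
    split; [|split; [|split]].
    + intros x y Hp; apply mono_is_derive_x with N; [lia | exact Hp].
    + intros x y Hp; apply mono_is_derive_y with N; [lia | exact Hp].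
    + unfold mono_dx.
      repeat first [apply Ck_witnessed_plus | apply Ck_witnessed_scal];
        apply IH; lia.
    + unfold mono_dy.
      repeat first [apply Ck_witnessed_plus | apply Ck_witnessed_scal];
        apply IH; lia.
Qed.

Lemma open_slit_domain (N : nat) : open (slit_domain N).
Proof.
  apply open_or.
  - apply (open_comp (fun p : R * R => snd p) (fun y => 0 < y)).
    + intros p _; apply continuous_snd.
    + apply open_gt.
  - apply (open_comp (fun p : R * R => fst p) (fun x => - / (INR N + 3) < x)).
    + intros p _; apply continuous_fst.
    + apply open_gt.
Qed.

Lemma X_sub_slit_domain (N : nat) (p : R * R) : X p -> slit_domain N p.
Proof.
  intros [H|[H _]]; [now left | right].
  generalize (pos_INR N); intros.
  assert (0 < / (INR N + 3)) by (apply Rinv_0_lt_compat; lra).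
  lra.
Qed.

(** * Failure of smoothness on a vertical slice *)

Lemma mono_slice (n : nat) (y : R) : 0 < y ->
  mono 0 0 0 (- / (INR n + / 2)) y = exp (- ((INR n + / 2) * (y - ln y))).
Proof.
  intros Hy; generalize (pos_INR n); intros Hn.
  rewrite mono_quadrant; [|apply Ropp_lt_gt_0_contravar, Rinv_0_lt_compat; lra|
    exact Hy].
  rewrite Rinv_opp, Rinv_inv; simpl; rewrite !Rmult_1_l; f_equal; ring.
Qed.

Lemma Taylor_flat (h : R -> R) (d : R) (q : nat) : 0 < d ->
  (forall t r, 0 <= t < d -> ex_derive_n h r t) ->
  (forall r, (r < q)%nat -> Derive_n h r 0 = 0) ->
  forall y, 0 < y < d -> exists z, 0 <= z <= y /\
    h y = y ^ q / INR (Factorial.fact q) * Derive_n h q z.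
Proof.
  intros Hd Hh H0 y Hy.
  destruct q as [|q].
  { exists y; split; [lra | simpl; field]. }
  destruct (Taylor_Lagrange h q 0 y) as [z [Hz E]]; [lra| |].
  { intros t Ht k _; apply Hh; lra. }
  exists z; split; [lra|].
  rewrite E, Rminus_0_r.
  rewrite sum_eq_R0; [ring|].
  intros r Hr; rewrite H0 by lia; ring.
Qed.

(** The substitution [y = t^2] makes the half-integer power a polynomial:
    [y^(n + 1/2) = y^n t]. *)
Lemma slice_value (n : nat) (t : R) : 0 < t ->
  exp (- ((INR n + / 2) * (t ^ 2 - ln (t ^ 2)))) =
  (t ^ 2) ^ n * t * exp (- ((INR n + / 2) * t ^ 2)).
Proof.
  intros Ht.
  assert (Hl : ln (t ^ 2) = 2 * ln t).
  { replace (t ^ 2) with (t * t) by ring; rewrite ln_mult by assumption; ring. }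
  assert (Hp : (t ^ 2) ^ n * t = exp (INR (2 * n) * ln t + ln t)).
  { rewrite exp_plus, exp_ln by assumption.
    rewrite <- pow_mult, <- Rpower_pow by assumption; reflexivity. }
  rewrite Hp, <- exp_plus, Hl, mult_INR; f_equal; simpl; field.
Qed.

Lemma Derive_n_continuous (h : R -> R) (q : nat) (eps : R) :
  (forall r, ex_derive_n h r 0) -> 0 < eps ->
  exists d, 0 < d /\ forall z, 0 <= z < d ->
    Rabs (Derive_n h q z - Derive_n h q 0) < eps.
Proof.
  intros Hh He.
  assert (C : continuous (Derive_n h q) 0)
    by (apply (ex_derive_continuous (V := R_NormedModule)); exact (Hh (S q))).
  destruct (C (fun u => Rabs (u - Derive_n h q 0) < eps)) as [d Hd].
  { exists (mkposreal eps He); intros u Hu; exact Hu. }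
  exists d; split; [apply cond_pos|]; intros z Hz.
  apply Hd; unfold ball; simpl.
  unfold AbsRing_ball, abs, minus, plus, opp; simpl.
  rewrite Ropp_0, Rplus_0_r, Rabs_pos_eq; lra.
Qed.

(** The slice is exactly of order [n + 1/2] at [0], whereas a smooth function is
    of integral or infinite order, its order being the index of the first
    derivative that does not vanish at [0].  Concretely, that index cannot be at
    most [n], since [y^(n + 1/2)] is negligible before [y^q] for [q <= n], and
    cannot be larger, since [y^(n + 1/2)] is not O(y^(n+1)). *)
Lemma half_order_not_smooth (n : nat) (h : R -> R) (d : R) : 0 < d ->
  (forall t r, 0 <= t < d -> ex_derive_n h r t) ->
  (forall y, 0 < y < d -> h y = exp (- ((INR n + / 2) * (y - ln y)))) ->
  False.
Proof.
  intros Hd Hh Hy.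
  generalize (pos_INR n); intros Hn.
  set (a := INR n + / 2) in *.
  assert (Hh0 : forall r, ex_derive_n h r 0) by (intros r; apply Hh; lra).
  (* Taylor's formula at [y = t^2]; [D] is the derivative of order [q] at the
     intermediate point, close to its value at [0] by continuity *)
  assert (Taylor : forall q e, 0 < e ->
    (forall r, (r < q)%nat -> Derive_n h r 0 = 0) ->
    exists t0, 0 < t0 <= 1 /\ forall t, 0 < t < t0 ->
      exists D, Rabs (D - Derive_n h q 0) < e /\
      (t ^ 2) ^ n * t * exp (- (a * t ^ 2)) =
      (t ^ 2) ^ q * (D / INR (Factorial.fact q))).
  { intros q e He H0.
    destruct (Derive_n_continuous h q e Hh0 He) as [d' [Hd' Hc]].
    assert (0 < Rmin 1 (Rmin d d')) by (repeat apply Rmin_pos; lra).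
    exists (Rmin 1 (Rmin d d')); split; [split; [assumption|apply Rmin_l]|].
    intros t [Ht0 Ht].
    apply Rmin_Rgt_l in Ht; destruct Ht as [Ht1 Ht].
    apply Rmin_Rgt_l in Ht; destruct Ht as [Htd Htd'].
    assert (Hsq : 0 < t ^ 2 < t) by nra.
    destruct (Taylor_flat h d q Hd Hh H0 (t ^ 2)) as [z [Hz E]]; [lra|].
    exists (Derive_n h q z); split; [apply Hc; lra|].
    rewrite <- slice_value by assumption.
    fold a; rewrite <- Hy, E by lra.
    unfold Rdiv; ring. }
  assert (Vanish : forall q, (q <= n)%nat ->
    forall r, (r <= q)%nat -> Derive_n h r 0 = 0).
  { assert (Step : forall q, (q <= n)%nat ->
      (forall r, (r < q)%nat -> Derive_n h r 0 = 0) -> Derive_n h q 0 = 0).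
    { intros q Hq H0.
      destruct (Req_dec (Derive_n h q 0) 0) as [E|E]; [exact E|exfalso].
      set (c := Derive_n h q 0) in *.
      assert (Hc : 0 < Rabs c) by now apply Rabs_pos_lt.
      destruct (Taylor q (Rabs c / 2) ltac:(lra) H0) as [t0 [Ht0 Ht]].
      fold c in Ht.
      set (F := INR (Factorial.fact q)) in *.
      assert (HF : 0 < F) by apply INR_fact_lt_0.
      set (b := Rabs c / 2 / F).
      assert (Hb : 0 < b) by (apply Rdiv_lt_0_compat; lra).
      (* for [t <= b] the term [y^q D / q!] is larger than [y^q t] *)
      set (t := Rmin (t0 / 2) b).
      assert (Pt : 0 < t) by (apply Rmin_pos; lra).
      assert (Lt0 : t <= t0 / 2) by apply Rmin_l.
      assert (Lb : t <= b) by apply Rmin_r.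
      destruct (Ht t ltac:(lra)) as [D [HD E']].
      assert (HDc : Rabs c / 2 < Rabs D).
      { generalize (Rabs_triang_inv c (c - D)).
        replace (c - (c - D)) with D by ring.
        rewrite (Rabs_minus_sym c D); lra. }
      assert (Pq : 0 < (t ^ 2) ^ q) by (apply pow_lt; nra).
      apply (f_equal Rabs) in E'.
      rewrite !Rabs_mult in E'.
      rewrite (Rabs_pos_eq t), (Rabs_pos_eq (exp _)),
        !(Rabs_pos_eq ((t ^ 2) ^ _)) in E'
        by (try (left; apply exp_pos); try (apply pow_le; nra); lra).
      unfold Rdiv in E'; rewrite Rabs_mult, Rabs_inv, (Rabs_pos_eq F) in E'
        by lra.
      assert (Lhs : (t ^ 2) ^ n * t * exp (- (a * t ^ 2)) <= (t ^ 2) ^ q * t).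
      { rewrite <- (Rmult_1_r ((t ^ 2) ^ q * t)).
        apply Rmult_le_compat.
        - apply Rmult_le_pos; [apply pow_le; nra | lra].
        - left; apply exp_pos.
        - apply Rmult_le_compat_r; [lra|].
          replace n with (q + (n - q))%nat by lia.
          rewrite pow_add.
          rewrite <- (Rmult_1_r ((t ^ 2) ^ q)) at 2.
          apply Rmult_le_compat_l; [lra|].
          rewrite <- (pow1 (n - q)); apply pow_incr; nra.
        - rewrite <- exp_0; apply exp_le_compat.
          assert (0 <= a * t ^ 2) by (apply Rmult_le_pos; [unfold a|]; nra).
          lra. }
      rewrite E' in Lhs.
      apply Rmult_le_reg_l in Lhs; [|exact Pq].
      assert (b < Rabs D * / F).
      { apply Rmult_lt_compat_r; [now apply Rinv_0_lt_compat | exact HDc]. }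
      lra. }
    induction q as [|q IH]; intros Hq r Hr.
    - apply Step; [lia|]; intros; lia.
    - destruct (Nat.eq_dec r (S q)) as [->|Hne]; [|apply IH; lia].
      apply Step; [lia|]; intros r' Hr'; apply IH; lia. }
  (* at order [n + 1], dividing by [y^n t] gives [exp (- a y) = t D / (n + 1)!]:
     the left side stays above [exp (- a)], the right side tends to [0] *)
  destruct (Taylor (S n) 1 Rlt_0_1) as [t0 [Ht0 Ht]].
  { intros r Hr; apply (Vanish n); lia. }
  set (c := Derive_n h (S n) 0) in *.
  set (F := INR (Factorial.fact (S n))) in *.
  assert (HF : 0 < F) by apply INR_fact_lt_0.
  set (B := (Rabs c + 1) / F).
  assert (HB : 0 < B).
  { apply Rdiv_lt_0_compat; [generalize (Rabs_pos c)|]; lra. }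
  set (t := Rmin (t0 / 2) (exp (- a) / (2 * B))).
  assert (He : 0 < exp (- a)) by apply exp_pos.
  assert (Pt : 0 < t).
  { apply Rmin_pos; [|apply Rdiv_lt_0_compat]; lra. }
  assert (Lt0 : t <= t0 / 2) by apply Rmin_l.
  assert (Lt : t * B <= exp (- a) / 2).
  { apply Rle_trans with (exp (- a) / (2 * B) * B).
    - apply Rmult_le_compat_r; [lra | apply Rmin_r].
    - right; field; lra. }
  destruct (Ht t ltac:(lra)) as [D [HD E]].
  assert (Pn : 0 < (t ^ 2) ^ n * t)
    by (apply Rmult_lt_0_compat; [apply pow_lt; nra | lra]).
  assert (E1 : exp (- (a * t ^ 2)) = t * (D / F)).
  { apply Rmult_eq_reg_l with ((t ^ 2) ^ n * t); [|lra].
    rewrite E; simpl; ring. }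
  assert (E2 : exp (- a) <= exp (- (a * t ^ 2))).
  { apply exp_le_compat.
    assert (a * t ^ 2 <= a * 1) by (apply Rmult_le_compat_l; [unfold a|]; nra).
    lra. }
  assert (HDB : D / F <= B).
  { apply Rmult_le_compat_r; [left; now apply Rinv_0_lt_compat|].
    generalize (Rle_abs D) (Rabs_triang_inv D c); lra. }
  assert (t * (D / F) <= t * B) by (apply Rmult_le_compat_l; lra).
  lra.
Qed.

Lemma ex_diff_n_ex_derive_n (g : R -> R -> R) (x y : R) :
  (forall k, ex_diff_n g k x y) -> forall r, ex_derive_n (g x) r y.
Proof.
  intros H [|r]; [exact I|].
  exact (ex_diff_n_ex_deriv_inf_2 (S r) 0 r ltac:(lia) g x y (H (S r))).
Qed.

Theorem proposition3p1 :
  exists f : {p : R * R | X p} -> R,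
    ~ (exists (U : R * R -> Prop) (g : R * R -> R),
         open_nbhd X U /\ Cinfty_on U g /\ extends g f) /\
    (forall k : nat,
       exists (U : R * R -> Prop) (g : R * R -> R),
         open_nbhd X U /\ Ck_on k U g /\ extends g f).
Proof.
  exists (fun p => mono 0 0 0 (fst (proj1_sig p)) (snd (proj1_sig p))).
  split.
  - intros [U [g [[HU HX] [Hg Hext]]]].
    assert (H0 : U (0, 0)) by (apply HX; right; simpl; lra).
    destruct (open_locally_2d U 0 0 HU H0) as [d Hd].
    destruct (archimed_cor1 d (cond_pos d)) as [n [Hn Pn]].
    assert (Pn' : 0 < INR n) by now apply lt_0_INR.
    assert (Hx : Rabs (- / (INR n + / 2) - 0) < d).
    { rewrite Rminus_0_r, Rabs_Ropp, Rabs_pos_eq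
        by (left; apply Rinv_0_lt_compat; lra).
      apply Rle_lt_trans with (2 := Hn), Rinv_le_contravar; lra. }
    apply (half_order_not_smooth n (fun y => g (- / (INR n + / 2), y)) d
             (cond_pos d)).
    + intros t r Ht.
      apply (ex_diff_n_ex_derive_n (fun x y => g (x, y))).
      intros k; apply (Hg k (- / (INR n + / 2), t)), Hd; [exact Hx|].
      rewrite Rminus_0_r, Rabs_pos_eq; lra.
    + intros y Hy.
      rewrite <- mono_slice by lra.
      exact (Hext (exist _ (- / (INR n + / 2), y) (or_introl (proj1 Hy)))).
  - intros k.
    exists (slit_domain k), (fun p => mono 0 0 0 (fst p) (snd p)).
    split; [split|split].
    + apply open_slit_domain.
    + intros p; apply X_sub_slit_domain.
    + intros [x y] Hp; simpl.
      apply (Ck_witnessed_ex_diff_n (slit_domain k) k (open_slit_domain k));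
        [apply mono_Ck; lia | exact Hp].
    + intros p; reflexivity.
Qed.
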